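(* Let $a=(\alpha,\beta,1-\alpha,1-\beta)$ with $(\alpha,\beta)$ one of the following 14 pairs: $(\frac12,\frac12)$, $(\frac13,\frac23)$, $(\frac14,\frac12)$, $(\frac14,\frac14)$, $(\frac25,\frac15)$, $(\frac38,\frac18)$, $(\frac3{10},\frac1{10})$, $(\frac12,\frac16)$, $(\frac12,\frac13)$, $(\frac13,\frac16)$, $(\frac16,\frac16)$, $(\frac13,\frac14)$, $(\frac14,\frac16)$, $(\frac5{12},\frac1{12})$. Let $N$ be the smallest natural number such that $q(a|Nz)$ has integer coefficients. Let $z(q)$ be the inverse (under composition) of the power series $q(z):=\frac1N q(a|Nz)$, and let $\theta=z\frac{d}{dz}$. Put $$u_0(z):=z,\qquad u_{i+1}(z):=\theta^i\big(F(a|Nz)\big),\quad i=0,1,2,3,$$ $$u_{i+4}(z):=F(a|Nz)\,\theta^i\big(G(a|Nz)\big)-G(a|Nz)\,\theta^i\big(F(a|Nz)\big),\quad i=1,2.$$ Then $u_i(z(q))\in\mathbb{Z}[[q]]$ for $i=0,1,\dots,6$.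
   Context: For $a=(a_1,a_2,a_3,a_4)$ put $(x)_k=x(x+1)\cdots(x+k-1)$, $(x)_0=1$, and define the formal power series $$F(a|z)=\sum_{k=0}^\infty \frac{(a_1)_k\cdots(a_4)_k}{k!^4}z^k,\qquad G(a|z)=\sum_{k=1}^\infty \frac{(a_1)_k\cdots(a_4)_k}{k!^4}\Big[\sum_{j=1}^4\sum_{i=0}^{k-1}\Big(\frac1{a_j+i}-\frac1{1+i}\Big)\Big]z^k .$$ The mirror map is $q(a|z)=z\exp\big(G(a|z)/F(a|z)\big)\in\mathbb{Q}[[z]]$. $F(a|Nz)$, $G(a|Nz)$, $q(a|Nz)$ denote the series obtained by substituting $Nz$ for $z$. *)

(* Defs.v *)
From mathcomp Require Import all_boot all_order all_algebra.

Set Implicit Arguments.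
Unset Strict Implicit.
Unset Printing Implicit Defensive.

Import Order.TTheory GRing.Theory Num.Theory.
Local Open Scope ring_scope.

(* [f k] is the coefficient of z^k; series are compared with [=1]. *)
Definition fps := nat -> rat.

Definition fps_one : fps := fun k => (k == 0%N)%:R.
Definition fps_X : fps := fun k => (k == 1%N)%:R.
Definition fps_sub (f g : fps) : fps := fun k => f k - g k.
Definition fps_scale (c : rat) (f : fps) : fps := fun k => c * f k.
Definition fps_mul (f g : fps) : fps :=
  fun n => \sum_(i < n.+1) f i * g (n - i)%N.
Definition fps_pow (f : fps) (m : nat) : fps := iter m (fps_mul f) fps_one.

(* f(g(z)), meaningful only when [g 0 = 0]: then g^m has no term of degree
   below m, so truncating the sum at m = n loses nothing in degree n. *)
Definition fps_comp (f g : fps) : fps :=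
  fun n => \sum_(m < n.+1) f m * fps_pow g m n.

(* The geometric series in 1 - f / f_0, meaningful only when [f 0 != 0]. *)
Definition fps_inv (f : fps) : fps :=
  fps_scale (f 0%N)^-1
    (fps_comp (fun=> 1) (fps_sub fps_one (fps_scale (f 0%N)^-1 f))).
Definition fps_div (f g : fps) : fps := fps_mul f (fps_inv g).

(* exp(f(z)), meaningful only when [f 0 = 0]. *)
Definition fps_exp (f : fps) : fps := fps_comp (fun m => (m`!%:R)^-1) f.

(* f(c z) *)
Definition fps_dilate (c : rat) (f : fps) : fps := fun k => c ^+ k * f k.

(* theta = z d/dz *)
Definition theta (f : fps) : fps := fun k => k%:R * f k.

Definition fps_integral (f : fps) : Prop := forall k, f k \is a Num.int.

Definition is_comp_inverse (f g : fps) : Prop :=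
  [/\ f 0%N = 0, g 0%N = 0, fps_comp f g =1 fps_X & fps_comp g f =1 fps_X].

Definition pochhammer (x : rat) (k : nat) : rat := \prod_(i < k) (x + i%:R).

Definition hgF (a : 4.-tuple rat) : fps := fun k =>
  (\prod_(j < 4) pochhammer (tnth a j) k) / k`!%:R ^+ 4.

(* The bracket is an empty sum at k = 0, so the series starts at k = 1. *)
Definition hgG (a : 4.-tuple rat) : fps := fun k =>
  (\prod_(j < 4) pochhammer (tnth a j) k) / k`!%:R ^+ 4 *
  (\sum_(j < 4) \sum_(i < k) ((tnth a j + i%:R)^-1 - (1 + i%:R)^-1)).

Definition mirror_map (a : 4.-tuple rat) : fps :=
  fps_mul fps_X (fps_exp (fps_div (hgG a) (hgF a))).

(* N = 0 is excluded: q(a|0) = 0 is trivially integral. *)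
Definition is_smallest_integral_dilation (a : 4.-tuple rat) (N : nat) : Prop :=
  [/\ (0 < N)%N, fps_integral (fps_dilate N%:R (mirror_map a)) &
      forall M : nat, (0 < M)%N ->
        fps_integral (fps_dilate M%:R (mirror_map a)) -> (N <= M)%N].

Definition cy_pairs : seq (rat * rat) :=
  [:: (1 / 2, 1 / 2); (1 / 3, 2 / 3); (1 / 4, 1 / 2); (1 / 4, 1 / 4);
      (2 / 5, 1 / 5); (3 / 8, 1 / 8); (3 / 10, 1 / 10); (1 / 2, 1 / 6);
      (1 / 2, 1 / 3); (1 / 3, 1 / 6); (1 / 6, 1 / 6); (1 / 3, 1 / 4);
      (1 / 4, 1 / 6); (5 / 12, 1 / 12)].

Definition cy_param (alpha beta : rat) : 4.-tuple rat :=
  [tuple alpha; beta; 1 - alpha; 1 - beta].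

(* u_0, ..., u_6; the indices i > 6 are never used. *)
Definition u_series (a : 4.-tuple rat) (N i : nat) : fps :=
  let F := fps_dilate N%:R (hgF a) in
  let G := fps_dilate N%:R (hgG a) in
  if i == 0%N then fps_X
  else if (i <= 4)%N then iter i.-1 theta F
  else fps_sub (fps_mul F (iter (i - 4)%N theta G))
               (fps_mul G (iter (i - 4)%N theta F)).

(* Main.v *)
From HB Require Import structures.
From Stdlib Require Import BinNums BinInt QArith_base Qreduction.
From mathcomp Require Import all_boot all_order all_algebra.
From mathcomp Require Import ring zify ssrZ.
From mathcomp Require Import boolp.
Require Import Defs.

Set Implicit Arguments.
Unset Strict Implicit.
Unset Printing Implicit Defensive.

Import Order.TTheory GRing.Theory Num.Theory.
Local Open Scope ring_scope.

(** Write [g = G / F] and [h = exp g], all dilated by [N], so that the mirror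
    map is [q = z h].  Everything follows from the integrality of [h] and [F].
    Indeed [z (q)] is then the inverse of an integral series tangent to the
    identity, hence integral; [theta h = h theta g] makes [theta g] integral;
    and
      [F theta G - G theta F = F ^ 2 theta g],
      [F theta ^ 2 G - G theta ^ 2 F = theta (F theta G - G theta F)].

    The hypothesis on [N] gives the integrality of [N h] only.  The step from
    [N h] to [h] is made one prime [p] at a time, and needs no congruence
    between hypergeometric coefficients ([zloc_of_bounded]).  If [F] is
    [p]-integral, the coefficients of [g] grow at most logarithmically for the
    [p]-adic absolute value, because those of [G] are the ones of [F] times
    harmonic sums.  So [g] converges on the open [p]-adic unit disc, its
    exponential [h] has no zero there, and a bounded function without zeros on
    that disc has constant absolute value: as [h 0 = 1], the series [h] is
    [p]-integral.  Zeros are replaced below by the first coefficient of maximal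
    absolute value, followed through the powers [h ^ (p ^ s)].

    The integrality of [F] amounts to a lower bound on the [p]-part of [N] for
    the primes [p] dividing the denominators of [alpha] and [beta]
    ([zloc_hgF]): the valuation of its [k]-th coefficient comes from the powers
    of [p] in the denominators and from the factorials.  A dilation with a
    smaller [p]-part is ruled out by one coefficient of [exp (G / F)], of
    degree at most 24 in the fourteen cases, whose denominator is too large
    ([logn_dilation]); these coefficients are computed exactly with binary
    rational numbers ([cy_rows_check]). *)

(** * The ring of formal power series *)

HB.instance Definition _ := gen_eqMixin fps.
HB.instance Definition _ := gen_choiceMixin fps.

Lemma fpsP (f g : fps) : f =1 g -> f = g.
Proof. exact: funext. Qed.

Definition fps_add (f g : fps) : fps := fun k => f k + g k.
Definition fps_opp (f : fps) : fps := fun k => - f k.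
Definition fps_zero : fps := fun=> 0.

Fact fps_addA : associative fps_add.
Proof. by move=> f g h; apply: fpsP => k; apply: addrA. Qed.
Fact fps_addC : commutative fps_add.
Proof. by move=> f g; apply: fpsP => k; apply: addrC. Qed.
Fact fps_add0 : left_id fps_zero fps_add.
Proof. by move=> f; apply: fpsP => k; apply: add0r. Qed.
Fact fps_addN : left_inverse fps_zero fps_opp fps_add.
Proof. by move=> f; apply: fpsP => k; apply: addNr. Qed.

HB.instance Definition _ :=
  GRing.isZmodule.Build fps fps_addA fps_addC fps_add0 fps_addN.

Definition fps_trunc (M : nat) (f : fps) : {poly rat} := \poly_(i < M.+1) f i.

(** The product of power series is computed on truncations, which lets the
    ring axioms be inherited from polynomials. *)
Lemma fps_mul_trunc (M : nat) (f g : fps) (n : nat) : (n <= M)%N ->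
  fps_mul f g n = (fps_trunc M f * fps_trunc M g)`_n.
Proof.
move=> le_nM; rewrite coefM; apply: eq_bigr => i _.
have le_in : (i <= n)%N by rewrite -ltnS.
by rewrite !coef_poly !ltnS (leq_trans le_in) // (leq_trans (leq_subr _ _)).
Qed.

Lemma coef_trunc (M : nat) (f : fps) (n : nat) :
  (n <= M)%N -> (fps_trunc M f)`_n = f n.
Proof. by move=> le_nM; rewrite coef_poly ltnS le_nM. Qed.

Fact fps_mulC : commutative fps_mul.
Proof.
by move=> f g; apply: fpsP => n; rewrite !(fps_mul_trunc _ _ (leqnn n)) mulrC.
Qed.

Fact fps_mulA : associative fps_mul.
Proof.
move=> f g h; apply: fpsP => n.
set T := fps_trunc n.
transitivity (T f * T g * T h)`_n; last first.
  rewrite coefM; apply: eq_bigr => i _.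
  rewrite coef_trunc ?leq_subr //; congr (_ * _).
  by rewrite (@fps_mul_trunc n) // -ltnS.
rewrite -mulrA coefM; apply: eq_bigr => i _.
by rewrite coef_trunc -1?ltnS // (@fps_mul_trunc n) // leq_subr.
Qed.

Fact fps_mul1 : left_id fps_one fps_mul.
Proof.
move=> f; apply: fpsP => n.
rewrite /fps_mul big_ord_recl subn0 mul1r big1 ?addr0 // => i _.
exact: mul0r.
Qed.

Fact fps_mulD : left_distributive fps_mul fps_add.
Proof.
move=> f g h; apply: fpsP => n; rewrite /fps_mul /fps_add -big_split /=.
by apply: eq_bigr => i _; rewrite mulrDl.
Qed.

Fact fps_one_neq0 : fps_one != fps_zero.
Proof. by apply/eqP => /(congr1 (fun f : fps => f 0%N)). Qed.

HB.instance Definition _ := GRing.Zmodule_isComNzRing.Build fps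
  fps_mulA fps_mulC fps_mul1 fps_mulD fps_one_neq0.

Lemma fps_coef1 n : (1 : fps) n = (n == 0%N)%:R. Proof. by []. Qed.
Lemma fps_coefD (f g : fps) n : (f + g) n = f n + g n. Proof. by []. Qed.
Lemma fps_coefN (f : fps) n : (- f) n = - f n. Proof. by []. Qed.
Lemma fps_coefB (f g : fps) n : (f - g) n = f n - g n. Proof. by []. Qed.

Lemma fps_coefM (f g : fps) n :
  (f * g) n = \sum_(i < n.+1) f i * g (n - i)%N.
Proof. by []. Qed.

Lemma fps_coefMn (f : fps) m n : (f *+ m) n = f n *+ m.
Proof. by elim: m => // m IHm; rewrite !mulrS fps_coefD IHm. Qed.

Lemma fps_coef_sum (I : Type) (r : seq I) (P : pred I) (f : I -> fps) n :
  (\sum_(i <- r | P i) f i) n = \sum_(i <- r | P i) f i n.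
Proof. exact: (big_morph (fun f : fps => f n)). Qed.

Lemma fps_powE (f : fps) m : fps_pow f m = f ^+ m.
Proof. by elim: m => // m IHm; rewrite exprS -IHm. Qed.

Lemma fps_coefM0 (f g : fps) : (f * g) 0%N = f 0%N * g 0%N.
Proof. by rewrite fps_coefM big_ord1. Qed.

Lemma fps_coefX0 (f : fps) m : (f ^+ m) 0%N = f 0%N ^+ m.
Proof. by elim: m => // m IHm; rewrite !exprS fps_coefM0 IHm. Qed.

Lemma fps_coefX_lt (f : fps) m n : f 0%N = 0 -> (n < m)%N -> (f ^+ m) n = 0.
Proof.
move=> f0; elim: m n => // m IHm n lt_nm.
rewrite exprS fps_coefM big_ord_recl f0 mul0r add0r big1 // => i _.
rewrite IHm ?mulr0 // lift0; have := ltn_ord i; lia.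
Qed.

Lemma fps_compE (f g : fps) M n : g 0%N = 0 -> (n < M)%N ->
  fps_comp f g n = \sum_(m < M) f m * (g ^+ m) n.
Proof.
move=> g0 lt_nM; rewrite /fps_comp.
rewrite (big_ord_widen_cond M xpredT (fun m => f m * fps_pow g m n)) //=.
rewrite big_mkcond; apply: eq_bigr => m _; rewrite fps_powE.
by case: ltnP => // lt_nm; rewrite fps_coefX_lt // mulr0.
Qed.

Lemma thetaM (f g : fps) : theta (f * g) = theta f * g + f * theta g.
Proof.
apply: fpsP => n; rewrite fps_coefD /theta !fps_coefM -big_split mulr_sumr.
apply: eq_bigr => i _ /=.
have -> : (n%:R : rat) = i%:R + (n - i)%:R by rewrite -natrD subnKC // -ltnS.
by ring.
Qed.

Lemma thetaX (f : fps) m : theta (f ^+ m.+1) = f ^+ m * theta f *+ m.+1.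
Proof.
elim: m => [|m IHm]; first by rewrite expr1 expr0 mul1r.
by rewrite exprS thetaM IHm [f ^+ m.+1]exprS; ring.
Qed.

Lemma fps_inv_mul (f : fps) : f 0%N = 1 -> f * fps_inv f = 1.
Proof.
move=> f0; apply: fpsP => n; set x := 1 - f.
have x0 : x 0%N = 0 by rewrite /x fps_coefB f0 subrr.
have invE i : (i < n.+1)%N -> fps_inv f i = (\sum_(m < n.+1) x ^+ m) i.
  move=> lt_in; rewrite /fps_inv /fps_scale f0 invr1 mul1r fps_coef_sum.
  have -> : fps_sub fps_one (fun k => 1 * f k) = x.
    by apply: fpsP => k; rewrite /fps_sub mul1r.
  by rewrite (fps_compE _ x0 lt_in); apply: eq_bigr => m _; rewrite mul1r.
transitivity ((f * \sum_(m < n.+1) x ^+ m) n).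
  by rewrite !fps_coefM; apply: eq_bigr => i _; rewrite invE // ltnS leq_subr.
have -> : f * \sum_(m < n.+1) x ^+ m = 1 - x ^+ n.+1.
  by rewrite -opprB subrX1 -mulNr opprB /x subKr.
by rewrite fps_coefB (fps_coefX_lt x0) // subr0.
Qed.

Lemma fps_exp0 (f : fps) : fps_exp f 0%N = 1.
Proof. by rewrite /fps_exp /fps_comp big_ord1 fact0 invr1 mul1r. Qed.

(** Termwise differentiation of the exponential series, both sides being
    truncated at a degree-dependent order. *)
Lemma theta_exp (f : fps) :
  f 0%N = 0 -> theta (fps_exp f) = fps_exp f * theta f.
Proof.
move=> f0; apply: fpsP => n.
have -> : theta (fps_exp f) n = n%:R * fps_exp f n by [].
rewrite {1}/fps_exp (@fps_compE _ f n.+2) // mulr_sumr big_ord_recl.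
rewrite /= expr0 fps_coef1 fact0 invr1 mul1r -natrM.
have -> : (n * (n == 0))%N = 0%N by case: n => // n; rewrite muln0.
rewrite add0r.
transitivity (\sum_(m < n.+1) m`!%:R^-1 * (f ^+ m * theta f) n).
  apply: eq_bigr => m _; rewrite /bump leq0n add1n mulrCA.
  have -> : n%:R * (f ^+ m.+1) n = theta (f ^+ m.+1) n by [].
  rewrite thetaX fps_coefMn factS natrM -mulr_natl.
  by field; rewrite nat1r !pnatr_eq0 -lt0n fact_gt0.
under eq_bigr do rewrite fps_coefM mulr_sumr.
rewrite exchange_big fps_coefM; apply: eq_bigr => i _ /=.
rewrite /fps_exp (@fps_compE _ f n.+1) // mulr_suml.
by apply: eq_bigr => m _; rewrite mulrA.
Qed.

(** * Rational numbers integral at a prime *)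

(** The localization of the integers at [p]; coprimality makes it a subring
    even when [p] is not prime. *)
Definition zloc (p : nat) : {pred rat} := fun x => coprime p `|denq x|.

Lemma denq_dvdn (x : rat) (n : nat) :
  n%:R * x \is a Num.int -> (`|denq x| %| n)%N.
Proof.
move=> /intrP[z nx_z].
have : n%:Z * numq x = z * denq x.
  by apply: (@intr_inj rat); rewrite !intrM -nx_z numqE mulrA.
move/(congr1 absz); rewrite !abszM absz_nat => e.
have : (`|denq x| %| n * `|numq x|)%N by rewrite e dvdn_mull.
by rewrite Gauss_dvdl // coprime_sym coprime_num_den.
Qed.

Lemma zlocP (p : nat) (x : rat) :
  reflect (exists2 n : nat, coprime p n & n%:R * x \is a Num.int)
          (x \in zloc p).
Proof.
apply: (iffP idP) => [px|[n pn /denq_dvdn dvd_n]].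
  exists `|denq x|%N => //; rewrite natr_absz ger0_norm ?denq_ge0 // mulrC.
  by rewrite -numqE; exact: intr_int.
exact: coprime_dvdr dvd_n pn.
Qed.

Fact zloc_subring (p : nat) : subring_closed (zloc p).
Proof.
split=> [|x y /zlocP[m pm mx] /zlocP[n pn ny]|
          x y /zlocP[m pm mx] /zlocP[n pn ny]]; apply/zlocP.
- by exists 1%N; rewrite ?coprimen1 ?mulr1.
- exists (m * n)%N; first by rewrite coprimeMr pm.
  have -> : (m * n)%:R * (x - y) = n%:R * (m%:R * x) - m%:R * (n%:R * y).
    by rewrite natrM; ring.
  by apply: rpredB; apply: rpredM; rewrite ?natr_int.
- exists (m * n)%N; first by rewrite coprimeMr pm.
  have -> : (m * n)%:R * (x * y) = (m%:R * x) * (n%:R * y).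
    by rewrite natrM; ring.
  by rewrite rpredM.
Qed.

HB.instance Definition _ (p : nat) :=
  GRing.isSubringClosed.Build rat (zloc p) (zloc_subring p).

Lemma zloc_int (p : nat) (x : rat) : x \is a Num.int -> x \in zloc p.
Proof. by move=> xZ; apply/zlocP; exists 1%N; rewrite ?coprimen1 ?mul1r. Qed.

Lemma zloc_nat (p n : nat) : n%:R \in zloc p.
Proof. exact/zloc_int/natr_int. Qed.

Lemma zloc_natV (p n : nat) : coprime p n -> n%:R^-1 \in zloc p.
Proof.
move=> pn; apply/zlocP; exists n => //.
by case: n pn => [|n] _; rewrite ?mul0r // mulfV ?pnatr_eq0.
Qed.

Lemma zloc_all_int (x : rat) :
  (forall p, prime p -> x \in zloc p) -> x \is a Num.int.
Proof.
move=> xp; rewrite Qint_def -absz_denq; apply: contraT => den_neq1.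
have den_gt1 : (1 < `|denq x|)%N.
  by have := absz_gt0 (denq x); rewrite denq_neq0; lia.
have : coprime (pdiv `|denq x|) `|denq x| by exact: xp (pdiv_prime den_gt1).
by rewrite prime_coprime ?pdiv_prime // pdiv_dvd.
Qed.

Lemma zloc_pX (p n : nat) : p%:R ^+ n \in zloc p.
Proof. by rewrite rpredX ?zloc_nat. Qed.

Lemma zloc_leX (p m n : nat) (x : rat) : (m <= n)%N ->
  p%:R ^+ m * x \in zloc p -> p%:R ^+ n * x \in zloc p.
Proof.
by move=> le_mn mx; rewrite -(subnK le_mn) exprD -mulrA rpredM ?zloc_pX.
Qed.

Lemma zloc_natV_logn (p n : nat) : prime p -> (0 < n)%N ->
  p%:R ^+ logn p n * n%:R^-1 \in zloc p.
Proof.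
move=> p_pr n_gt0; have [m pm def_n] := pfactor_coprime p_pr n_gt0.
rewrite [X in X%:R^-1]def_n natrM natrX invfM mulrCA mulfV ?mulr1 ?zloc_natV //.
by rewrite expf_neq0 // pnatr_eq0 -lt0n prime_gt0.
Qed.

Lemma zloc_natV_le (p n t : nat) : prime p -> (0 < n <= p ^ t)%N ->
  p%:R ^+ t * n%:R^-1 \in zloc p.
Proof.
move=> p_pr /andP[n_gt0 le_n]; apply: (@zloc_leX _ (logn p n)).
  rewrite -(leq_exp2l _ _ (prime_gt1 p_pr)); apply: leq_trans le_n.
  by rewrite dvdn_leq // pfactor_dvdnn.
exact: zloc_natV_logn.
Qed.

Lemma zloc_unit (p : nat) (x : rat) : prime p ->
  x \in zloc p -> x / p%:R \notin zloc p -> x^-1 \in zloc p.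
Proof.
move=> p_pr px xp; have [num0|num_neq0] := eqVneq (numq x) 0.
  by move: xp; rewrite -[x]divq_num_den num0 !mul0r rpred0.
apply/zlocP; exists `|numq x|%N; last first.
  rewrite -[x in x^-1]divq_num_den invf_div mulrCA.
  rewrite natr_absz normrEsg intrM mulfK ?intr_eq0 //.
  by apply: rpredM; exact: intr_int.
rewrite prime_coprime //; apply: contra xp => /dvdnP[c def_c].
apply/zlocP; exists `|denq x|%N => //; apply/intrP; exists (sgz (numq x) * c).
rewrite natr_absz ger0_norm ?denq_ge0 // mulrA [_ * x]mulrC -numqE.
rewrite [numq x in LHS]intEsg def_c PoszM !intrM -mulrA mulfK //.
by rewrite intr_eq0 -lt0n prime_gt0.
Qed.

Lemma zloc_unitM (p : nat) (x y : rat) : prime p ->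
  x \in zloc p -> x / p%:R \notin zloc p -> y / p%:R \notin zloc p ->
  x * y / p%:R \notin zloc p.
Proof.
move=> p_pr px xp; apply: contra => xyp.
have x0 : x != 0 by apply: contraNneq xp => ->; rewrite mul0r rpred0.
by rewrite -[y](mulKf x0) -mulrA rpredM // zloc_unit.
Qed.

(** * Exponentials with bounded coefficients *)

Lemma thetaD (f g : fps) : theta (f + g) = theta f + theta g.
Proof. by apply: fpsP => n; rewrite fps_coefD /theta -mulrDr. Qed.

Lemma thetaN (f : fps) : theta (- f) = - theta f.
Proof. by apply: fpsP => n; rewrite fps_coefN /theta fps_coefN mulrN. Qed.

Lemma thetaMn (f : fps) m : theta (f *+ m) = theta f *+ m.
Proof.
by apply: fpsP => n; rewrite fps_coefMn /theta fps_coefMn mulrnAr.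
Qed.

Lemma theta_log_coef (f h : fps) n : theta h = h * theta f ->
  n%:R * h n = \sum_(i < n) h i * ((n - i)%:R * f (n - i)%N).
Proof.
move=> eq_h; rewrite -[LHS]/(theta h n) eq_h fps_coefM big_ord_recr /=.
by rewrite subnn [theta f 0%N]mul0r mulr0 addr0.
Qed.

Lemma theta_log_inj (f h h' : fps) :
  theta h = h * theta f -> theta h' = h' * theta f ->
  h 0%N = h' 0%N -> h = h'.
Proof.
move=> eq_h eq_h' eq0; apply: fpsP => n.
elim/ltn_ind: n => -[//|n] IHn.
apply: (@mulfI _ n.+1%:R); first by rewrite pnatr_eq0.
rewrite (theta_log_coef _ eq_h) (theta_log_coef _ eq_h').
by apply: eq_bigr => i _; rewrite IHn.
Qed.

(** Legendre's estimate of the valuation of a factorial. *)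
Lemma logn_fact_le (p k : nat) : prime p -> (p.-1 * logn p k`! <= k)%N.
Proof.
move=> p_pr; rewrite logn_fact //.
suff H m : (p.-1 * (\sum_(1 <= j < m.+1) k %/ p ^ j) + k %/ p ^ m <= k)%N.
  exact: leq_trans (leq_addr _ _) (H k).
elim: m => [|m IHm]; first by rewrite big_geq // muln0 expn0 divn1.
rewrite big_nat_recr //= mulnDr -addnA.
apply: leq_trans IHm; rewrite leq_add2l -mulSnr prednK ?prime_gt0 //.
by rewrite expnSr divnMA mulnC leq_divM.
Qed.

Lemma zloc_pX_fact (p k : nat) : prime p -> p%:R ^+ k / k`!%:R \in zloc p.
Proof.
move=> p_pr; apply: (@zloc_leX _ (logn p k`!)).
  have := logn_fact_le k p_pr; have := prime_gt1 p_pr; nia.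
exact: zloc_natV_logn (fact_gt0 _).
Qed.

Lemma zloc_exp (p : nat) (f : fps) : prime p ->
  (forall n, f n / p%:R \in zloc p) -> forall n, fps_exp f n \in zloc p.
Proof.
move=> p_pr fp n; apply: rpred_sum => m _; rewrite fps_powE.
have p0 : p%:R != 0 :> rat by rewrite pnatr_eq0 -lt0n prime_gt0.
have fmp k j : (f ^+ k) j / p%:R ^+ k \in zloc p.
  elim: k j => [|k IHk] j.
    by rewrite !expr0 divr1 fps_coef1 zloc_nat.
  rewrite exprS fps_coefM mulr_suml; apply: rpred_sum => i _.
  by rewrite exprS invfM mulrACA rpredM.
have -> : m`!%:R^-1 * (f ^+ m) n =
          (p%:R ^+ m / m`!%:R) * ((f ^+ m) n / p%:R ^+ m).
  by field; rewrite expf_neq0 // pnatr_eq0 -lt0n fact_gt0.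
by rewrite rpredM ?zloc_pX_fact.
Qed.

(** Each use of the recurrence [n h_n = sum_i (n - i) f_(n - i) h_i] lowers the
    degree by more than [T], and loses at most [c] in the coefficient of [f] and
    [t] in the division by [n].  Since only [n / T] uses are possible, the loss
    is linear in [t], while [n] may be as large as [p ^ t]. *)
Lemma zloc_exp_tail (p T n0 t c : nat) (f h : fps) : prime p -> (0 < T)%N ->
  (n0 <= p ^ t)%N ->
  theta h = h * theta f -> h 0%N = 1 ->
  (forall k, (k <= T)%N -> f k = 0) ->
  (forall k, (k <= n0)%N -> p%:R ^+ c * f k \in zloc p) ->
  forall n, (n <= n0)%N -> p%:R ^+ ((c + t) * (n %/ T)) * h n \in zloc p.
Proof.
move=> p_pr T0 n0t eq_h h0 flow fp; elim/ltn_ind=> -[_ _|n IHn le_n].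
  by rewrite h0 mulr1 zloc_pX.
have -> : h n.+1 = n.+1%:R^-1 *
    \sum_(i < n.+1) h i * ((n.+1 - i)%:R * f (n.+1 - i)%N).
  by rewrite -theta_log_coef // mulKf ?pnatr_eq0.
rewrite mulrA mulr_sumr; apply: rpred_sum => i _.
have [le_T|lt_T] := leqP (n.+1 - i) T; first by rewrite flow // !mulr0 rpred0.
have lt_q : (i %/ T < n.+1 %/ T)%N.
  have : ((i + T) %/ T <= n.+1 %/ T)%N by apply: leq_div2r; lia.
  by rewrite divnDr // divnn T0 addn1.
have -> : ((c + t) * (n.+1 %/ T) =
  (c + t) * (n.+1 %/ T - i %/ T).-1 + (c + t) * (i %/ T) + (t + c))%N by nia.
rewrite !exprD.
set a := _ ^+ _; set b := _ ^+ _; set pt := _ ^+ _; set pc := _ ^+ _.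
have -> : a * b * (pt * pc) / n.+1%:R *
    (h i * ((n.+1 - i)%:R * f (n.+1 - i)%N)) =
  a * (b * h i) * (pt / n.+1%:R) * (n.+1 - i)%:R * (pc * f (n.+1 - i)%N).
  by ring.
apply: rpredM; last by apply: fp; lia.
apply: rpredM; last exact: zloc_nat.
apply: rpredM; last by apply: zloc_natV_le => //; lia.
by apply: rpredM; [exact: zloc_pX | apply: IHn => //; lia].
Qed.

(** The reduction of [f] modulo [p] has order exactly [m]. *)
Definition unit_order (p m : nat) (f : fps) : Prop :=
  [/\ forall i, f i \in zloc p, forall i, (i < m)%N -> f i / p%:R \in zloc p
    & f m / p%:R \notin zloc p].

Lemma unit_orderM (p m n : nat) (f g : fps) : prime p ->
  unit_order p m f -> unit_order p n g -> unit_order p (m + n) (f * g).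
Proof.
move=> p_pr [fp flow fm] [gp glow gn].
have lowi i j : (i < m)%N || (j < n)%N -> f i * g j / p%:R \in zloc p.
  case/orP=> [/flow|/glow] lt.
    by rewrite mulrAC rpredM.
  by rewrite -mulrA rpredM.
split=> [i|i lt_i|]; first by rewrite rpred_sum // => j _; rewrite rpredM.
  by rewrite mulr_suml rpred_sum // => j _; apply: lowi; have := ltn_ord j; lia.
have lt_m : (m < (m + n).+1)%N by lia.
rewrite fps_coefM (bigD1 (Ordinal lt_m)) //= mulrDl addKn.
rewrite rpredDr; first exact: zloc_unitM (fp _) fm gn.
rewrite mulr_suml rpred_sum // => j; rewrite -val_eqE /= => neq_j.
by apply: lowi; have := ltn_ord j; lia.
Qed.

Lemma unit_orderX (p m k : nat) (f : fps) : prime p ->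
  unit_order p m f -> unit_order p (m * k) (f ^+ k).
Proof.
move=> p_pr fm; elim: k => [|k IHk]; last first.
  by rewrite mulnS exprS; apply: unit_orderM.
rewrite muln0 expr0; split=> [i|//|]; first by rewrite fps_coef1 zloc_nat.
rewrite fps_coef1 mul1r; apply/negP => /zlocP[n pn /intrP[z]].
move/(congr1 ( *%R^~ p%:R)); rewrite mulfVK; last first.
  by rewrite pnatr_eq0 -lt0n prime_gt0.
move=> e; have : (p %| n)%N.
  have -> : n = absz (z * p%:Z); last by rewrite abszM dvdn_mull.
  by rewrite -[n]absz_nat; congr absz; apply: (@intr_inj rat); rewrite intrM.
by move: pn; rewrite prime_coprime // => /negP.
Qed.

Lemma exp_beats_linear (p a b : nat) : (1 < p)%N ->
  exists s, ((a + s) * b < p ^ s)%N.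
Proof.
move=> p_gt1; pose u := ((a + 2) * b)%N; exists (2 * u)%N.
(* [p ^ (2 u)] exceeds [(u + 1) ^ 2], which is quadratic in [b]. *)
have lt_u : (u < p ^ u)%N by apply: ltn_expl.
rewrite mulnC expnM mulnC expnAC; nia.
Qed.

(** A non-integral [h] with bounded coefficients would vanish somewhere in the
    open unit disc, whereas the logarithmic growth of [g] makes it converge
    there, so that [h = exp g] has no zero.

    Concretely, let [p ^ (v + 1)] be the exact bound of the denominators of [h],
    attained for the first time in degree [m].  Then [h ^ M] attains
    [p ^ ((v + 1) M)] in degree [m M].  For [M = p ^ s], however, [h ^ M] is the
    exponential of [M g], whose coefficients of degree at most [T = M / p ^
    (c + 1)] are divisible by [p] and thus have an integral exponential; the
    others enter at most [K = m M / T] times in degree [m M], and their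
    contribution has a denominator whose exponent [E] is only linear in [s]. *)
Lemma zloc_of_bounded (p c v : nat) (g h : fps) : prime p ->
  h 0%N = 1 -> g 0%N = 0 -> theta h = h * theta g ->
  (forall t k, (k <= p ^ t)%N -> p%:R ^+ (t + c) * g k \in zloc p) ->
  (forall n, p%:R ^+ v * h n \in zloc p) -> forall n, h n \in zloc p.
Proof.
move=> p_pr h0 g0 eq_h growth; elim: v => [|v IHv] hv n.
  by have := hv n; rewrite mul1r.
apply: IHv => {}n; apply: contraT => hn.
have p0 : p%:R != 0 :> rat by rewrite pnatr_eq0 -lt0n prime_gt0.
pose P := fps_scale (p%:R ^+ v.+1) h.
have P_div i : P i / p%:R = p%:R ^+ v * h i.
  by rewrite /P /fps_scale exprSr; field.
have [m Pm] : exists m, unit_order p m P.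
  have exP : exists n, P n / p%:R \notin zloc p by exists n; rewrite P_div.
  case: (ex_minnP exP) => m Pm min_m; exists m; split=> // i lt_im.
  by apply: contraTT lt_im => /min_m; rewrite -leqNgt.
pose K := (m * p ^ c.+1)%N.
have [s' lt_s'] := exp_beats_linear (m + c + m + c + 1) K (prime_gt1 p_pr).
pose T := (p ^ s')%N; pose s := (c + 1 + s')%N; pose M := (p ^ s)%N.
have M_gt0 : (0 < M)%N by rewrite expn_gt0 prime_gt0.
pose f := g *+ M; pose A := h ^+ M; pose E := ((m + c + (m + s)) * K)%N.
have PM k : (P ^+ k) =1 fps_scale ((p%:R ^+ v.+1) ^+ k) (h ^+ k).
  elim: k => [|k IHk] i; first by rewrite !expr0 /fps_scale mul1r.
  rewrite [P ^+ _]exprS [h ^+ _]exprS [in RHS]exprS.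
  rewrite fps_coefM /fps_scale fps_coefM mulr_sumr.
  by apply: eq_bigr => j _; rewrite IHk /P /fps_scale mulrACA.
have [_ _] := unit_orderX M p_pr Pm.
rewrite PM /fps_scale -exprM -/A => /negP[].
suff EA : p%:R ^+ E * A (m * M)%N \in zloc p.
  have lt_E : (E < v.+1 * M)%N.
    rewrite /E /M /s !expnD; move: lt_s'; rewrite /K; set q := (p ^ s')%N.
    have : (0 < p ^ c * p ^ 1)%N by rewrite -expnD expn_gt0 prime_gt0.
    by nia.
  have -> : (v.+1 * M = (v.+1 * M).-1.+1)%N by lia.
  rewrite exprS; set x := p%:R ^+ _; set y := A _.
  have -> : p%:R * x * y / p%:R = x * y by field.
  by apply: zloc_leX EA; lia.
have eq_A : theta A = A * theta f.
  rewrite /A /f -(prednK M_gt0) thetaX eq_h thetaMn [h ^+ _.+1]exprSr.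
  by ring.
(* Low and high degree parts of [M g]. *)
pose f1 : fps := fun k => if (k <= T)%N then f k else 0.
pose f2 : fps := f - f1.
have f0 : f 0%N = 0 by rewrite /f fps_coefMn g0 mul0rn.
have f10 : f1 0%N = 0 by rewrite /f1 f0.
have f20 : f2 0%N = 0 by rewrite /f2 fps_coefB f0 f10 subr0.
have def_A : A = fps_exp f1 * fps_exp f2.
  apply: (theta_log_inj eq_A); last first.
    by rewrite fps_coefM0 !fps_exp0 mulr1 /A fps_coefX0 h0 expr1n.
  have -> : theta f = theta f1 + theta f2 by rewrite -thetaD /f2 subrKC.
  by rewrite thetaM !theta_exp //; ring.
have fp k : f k = p%:R ^+ s * g k.
  by rewrite /f fps_coefMn -[LHS]mulr_natl /M natrX.
have B_int : forall n, fps_exp f1 n \in zloc p.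
  apply: zloc_exp => // k; rewrite /f1; case: leqP => [le_k|_]; last first.
    by rewrite mul0r rpred0.
  rewrite fp /s addn1 addSn exprS addnC; set x := p%:R ^+ _.
  have -> : p%:R * x * g k / p%:R = x * g k by field.
  exact: growth.
have C_int : forall n, (n <= m * M)%N ->
    p%:R ^+ ((m + c + (m + s)) * (n %/ T)) * fps_exp f2 n \in zloc p.
  apply: (@zloc_exp_tail p T _ _ _ f2) => //.
  - by rewrite expn_gt0 prime_gt0.
  - by rewrite expnD leq_mul2r ltnW ?orbT // ltn_expl ?prime_gt1.
  - exact: theta_exp.
  - exact: fps_exp0.
  - by move=> k le_k; rewrite /f2 fps_coefB /f1 le_k subrr.
  - move=> k le_k; rewrite /f2 fps_coefB /f1; case: leqP => _.
      by rewrite subrr mulr0 rpred0.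
    rewrite subr0 fp mulrA -exprD.
    have -> : (m + c + s = m + s + c)%N by lia.
    apply: growth; apply: leq_trans le_k _.
    by rewrite expnD leq_mul2r ltnW ?orbT // ltn_expl ?prime_gt1.
rewrite def_A fps_coefM mulr_sumr; apply: rpred_sum => i _.
rewrite mulrCA; apply: rpredM => //.
apply: zloc_leX (C_int _ (leq_subr _ _)); rewrite leq_mul2l.
have -> : K = (m * M %/ T)%N.
  by rewrite /M /s expnD mulnA mulnK ?expn_gt0 ?prime_gt0 // addn1.
by rewrite leq_div2r ?orbT // leq_subr.
Qed.

(** * Denominators of the hypergeometric coefficients *)

Lemma dvdn_fact_rising (x k : nat) : (k`! %| \prod_(i < k) (x + i))%N.
Proof.
case: x => [|x].
  case: k => [|k]; first by rewrite big_ord0.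
  by rewrite big_ord_recl mul0n dvdn0.
have E : (\prod_(i < k) (x.+1 + i) * x`! = (x + k)`!)%N.
  elim: k => [|k IHk]; first by rewrite big_ord0 addn0 mul1n.
  by rewrite big_ord_recr mulnAC IHk addnS factS mulnC.
rewrite -(dvdn_pmul2r (fact_gt0 x)) E.
rewrite -(bin_fact (leq_addl x k)) addnK.
exact: dvdn_mull.
Qed.

(** Modulo [q] the progression [r + i d] is, up to the unit [d], a product of
    consecutive integers. *)
Lemma dvdn_fact_progression (q r d k : nat) : coprime d q -> (q %| k`!)%N ->
  (q %| \prod_(i < k) (r + i * d))%N.
Proof.
move=> dq q_fact; have [d0|d_gt0] := posnP d.
  by move: dq; rewrite d0 /coprime gcd0n => /eqP->.
have [[t u] /= def_t] := coprimeP _ d_gt0 dq.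
have tq : coprime q (t ^ k).
  apply: coprimeXr; rewrite coprime_sym; have [t0|t_gt0] := posnP t.
    by move: def_t; rewrite t0.
  by apply/(coprimeP _ t_gt0); exists (d, u); rewrite /= mulnC.
rewrite -(Gauss_dvdr _ tq).
have -> : (t ^ k * \prod_(i < k) (r + i * d) =
           \prod_(i < k) (t * (r + i * d)))%N.
  by rewrite big_split /= prod_nat_const card_ord.
rewrite /dvdn.
have -> : (\prod_(i < k) (t * (r + i * d)) =
           \prod_(i < k) (t * r + i) %[mod q])%N.
  apply: (big_ind2 (fun x y => x = y %[mod q])) => // [a b c e ab ce|i _].
    by rewrite -modnMm ab ce modnMm.
  have -> : (t * (r + i * d) = i * u * q + (t * r + i))%N by nia.
  by rewrite modnMDl.
exact: dvdn_trans q_fact (dvdn_fact_rising _ _).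
Qed.

Lemma pochhammer_frac (r d k : nat) : (0 < d)%N ->
  pochhammer (r%:R / d%:R) k =
  (\prod_(i < k) (r + i * d))%N%:R / d%:R ^+ k.
Proof.
move=> d_gt0; rewrite /pochhammer natr_prod.
transitivity (\prod_(i < k) ((r + i * d)%N%:R / d%:R : rat)); last first.
  by rewrite big_split /= prodr_const card_ord exprVn.
apply: eq_bigr => i _; rewrite natrD natrM.
by field; rewrite pnatr_eq0 -lt0n.
Qed.

Lemma zloc_pochhammer (p r d k : nat) : prime p -> (0 < d)%N ->
  p%:R ^+ (logn p d * k + (p %| d) * logn p k`!) *
    (pochhammer (r%:R / d%:R) k / k`!%:R) \in zloc p.
Proof.
move=> p_pr d_gt0; rewrite pochhammer_frac //.
set Q := (\prod_(i < k) _)%N.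
have dX : p%:R ^+ (logn p d * k) * (d ^ k)%:R^-1 \in zloc p.
  by rewrite mulnC -lognX zloc_natV_logn // expn_gt0 d_gt0.
rewrite exprD -(natrX _ d k).
set x := p%:R ^+ _; set y := p%:R ^+ _.
have -> : x * y * (Q%:R / (d ^ k)%:R / k`!%:R) =
          (x / (d ^ k)%:R) * (y * (Q%:R / k`!%:R)) by ring.
apply: rpredM => //; rewrite /y; have [p_d|p_d] := boolP (p %| d)%N.
  by rewrite mul1n mulrCA rpredM ?zloc_nat ?zloc_natV_logn ?fact_gt0.
rewrite mul0n mul1r.
have dp : coprime d (p ^ logn p k`!).
  by rewrite coprime_sym coprimeXl // prime_coprime.
have /dvdnP[c ->] : (p ^ logn p k`! %| Q)%N.
  exact: dvdn_fact_progression dp (pfactor_dvdnn _ _).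
by rewrite natrM natrX -mulrA rpredM ?zloc_nat ?zloc_natV_logn ?fact_gt0.
Qed.

Lemma zloc_natM_logn (p n e : nat) (x : rat) : prime p -> (0 < n)%N ->
  (e <= logn p n)%N -> p%:R ^+ e * x \in zloc p -> n%:R * x \in zloc p.
Proof.
move=> p_pr n_gt0 le_e ex; have [m _ ->] := pfactor_coprime p_pr n_gt0.
by rewrite natrM natrX -mulrA rpredM ?zloc_nat // (zloc_leX le_e).
Qed.

Lemma cy_param_frac (r1 d1 r2 d2 : nat) :
  (r1 <= d1)%N -> (r2 <= d2)%N -> (0 < d1)%N -> (0 < d2)%N ->
  cy_param (r1%:R / d1%:R) (r2%:R / d2%:R) =
  [tuple r1%:R / d1%:R; r2%:R / d2%:R;
         (d1 - r1)%:R / d1%:R; (d2 - r2)%:R / d2%:R].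
Proof.
move=> le1 le2 d1_gt0 d2_gt0; apply: val_inj => /=.
by rewrite !natrB // !mulrBl !divff // pnatr_eq0 -lt0n.
Qed.

Section Hypergeometric.

Variables (r1 d1 r2 d2 : nat).
Hypotheses (rd1 : (0 < r1 < d1)%N) (rd2 : (0 < r2 < d2)%N).

Let a := cy_param (r1%:R / d1%:R) (r2%:R / d2%:R).

Let aE : a = [tuple r1%:R / d1%:R; r2%:R / d2%:R;
                    (d1 - r1)%:R / d1%:R; (d2 - r2)%:R / d2%:R].
Proof. by apply: cy_param_frac; lia. Qed.

(** This is [p - 1] times the exponent [e] for which [p ^ (e k)] bounds the
    [p]-part of the denominator of the [k]-th hypergeometric coefficient: a
    parameter whose denominator [d] is divisible by [p] contributes [v_p(d)],
    and [1 / (p - 1)] for the factorial below it. *)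
Definition cy_slope (p : nat) : nat :=
  (2 * (p.-1 * logn p d1 + (p %| d1)) + 2 * (p.-1 * logn p d2 + (p %| d2)))%N.

(** The factorials contribute at most [k / (p - 1)] each, by [logn_fact_le]. *)
Lemma zloc_hgF (p N k : nat) : prime p -> (0 < N)%N ->
  (cy_slope p <= p.-1 * logn p N)%N ->
  fps_dilate N%:R (hgF a) k \in zloc p.
Proof.
move=> p_pr N_gt0 slopeN.
have d1_gt0 : (0 < d1)%N by lia.
have d2_gt0 : (0 < d2)%N by lia.
rewrite /fps_dilate -natrX.
set e1 := (logn p d1 * k + (p %| d1) * logn p k`!)%N.
set e2 := (logn p d2 * k + (p %| d2) * logn p k`!)%N.
apply: (@zloc_natM_logn _ _ (e1 + e2 + (e1 + e2))) => //.
- by rewrite expn_gt0 N_gt0.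
- rewrite lognX.
  have p1_gt0 : (0 < p.-1)%N by have := prime_gt1 p_pr; lia.
  rewrite -(leq_pmul2l p1_gt0); have := logn_fact_le k p_pr.
  move: slopeN; rewrite /cy_slope /e1 /e2.
  set b1 : nat := (p %| d1)%N; set b2 : nat := (p %| d2)%N.
  set L := logn p k`!; set w := p.-1 => slopeN le_L.
  apply: (@leq_trans (k * (w * logn p N)))%N; last by rewrite mulnCA.
  apply: leq_trans (leq_mul (leqnn k) slopeN).
  have := leq_mul (leqnn b1) le_L; have := leq_mul (leqnn b2) le_L; nia.
rewrite /hgF aE !big_ord_recl big_ord0 mulr1 !(tnth_nth 0) /=.
rewrite (exprD _ (e1 + e2)) (exprD _ e1 e2).
have H r d := zloc_pochhammer r k p_pr (d := d).
set x1 := pochhammer _ _; set x2 := pochhammer _ _.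
set x3 := pochhammer _ _; set x4 := pochhammer _ _.
set P1 : rat := p%:R ^+ e1; set P2 : rat := p%:R ^+ e2.
have -> : P1 * P2 * (P1 * P2) * (x1 * (x2 * (x3 * x4)) / k`!%:R ^+ 4) =
   (P1 * (x1 / k`!%:R)) * (P2 * (x2 / k`!%:R)) *
   (P1 * (x3 / k`!%:R)) * (P2 * (x4 / k`!%:R)).
  by field; rewrite pnatr_eq0 -lt0n fact_gt0.
by do 3 (apply: rpredM; last exact: H); exact: H.
Qed.

Lemma zloc_inv_progression (p t c r d i k : nat) : prime p ->
  (0 < r <= d)%N -> (d <= p ^ c)%N -> (i < k <= p ^ t)%N ->
  p%:R ^+ (t + c) * (r%:R / d%:R + i%:R)^-1 \in zloc p.
Proof.
move=> p_pr /andP[r_gt0 le_rd] le_d /andP[lt_ik le_k].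
have -> : (r%:R / d%:R + i%:R)^-1 = d%:R * (r + i * d)%:R^-1 :> rat.
  rewrite natrD natrM; field.
  by rewrite -natrM -natrD !pnatr_eq0; lia.
rewrite mulrCA rpredM ?zloc_nat // zloc_natV_le // expnD; apply/andP; nia.
Qed.

Lemma hgF_0 (b : 4.-tuple rat) : hgF b 0%N = 1.
Proof.
rewrite /hgF fact0 expr1n divr1 big1 // => j _.
by rewrite /pochhammer big_ord0.
Qed.

(** The coefficients of [G] are those of [F] times sums of inverses of integers
    at most [(d1 + d2) k], whose denominators grow logarithmically. *)
Lemma zloc_hgG (p N t k : nat) : prime p -> (0 < N)%N ->
  (cy_slope p <= p.-1 * logn p N)%N -> (k <= p ^ t)%N ->
  p%:R ^+ (t + (d1 + d2)) * fps_dilate N%:R (hgG a) k \in zloc p.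
Proof.
move=> p_pr N_gt0 slopeN le_k.
have -> : fps_dilate N%:R (hgG a) k = fps_dilate N%:R (hgF a) k *
  \sum_(j < 4) \sum_(i < k) ((tnth a j + i%:R)^-1 - (1 + i%:R)^-1).
  by rewrite /fps_dilate /hgG mulrA.
rewrite mulrCA rpredM ?zloc_hgF //.
have le_d : (d1 + d2 <= p ^ (d1 + d2))%N.
  by rewrite ltnW // ltn_expl // prime_gt1.
have one i : (i < k)%N -> p%:R ^+ (t + (d1 + d2)) * (1 + i%:R)^-1 \in zloc p.
  move=> lt_i; rewrite -[X in X + _](@divff _ 1%:R) //.
  by apply: (@zloc_inv_progression _ _ _ _ _ _ k); rewrite ?lt_i //; lia.
rewrite mulr_sumr; apply: rpred_sum => j _.
rewrite mulr_sumr; apply: rpred_sum => i _.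
rewrite mulrBr; apply: rpredB; last exact: one.
have [r [d [-> r_gt0 le_d']]] : exists r d, [/\ tnth a j = r%:R / d%:R,
    (0 < r <= d)%N & (d <= d1 + d2)%N].
  rewrite aE (tnth_nth 0); case: j => -[|[|[|[|//]]]] lt_j /=.
  - by exists r1, d1; split => //; lia.
  - by exists r2, d2; split => //; lia.
  - by exists (d1 - r1)%N, d1; split => //; lia.
  - by exists (d2 - r2)%N, d2; split => //; lia.
apply: (@zloc_inv_progression _ _ _ _ _ _ k) => //.
  exact: leq_trans le_d' le_d.
by rewrite ltn_ord.
Qed.

End Hypergeometric.

(** * Coefficients of the mirror map in binary arithmetic *)


Definition ratZ (x : Z) : rat := (int_of_Z x)%:~R.

Lemma ratZD x y : ratZ (Z.add x y) = ratZ x + ratZ y.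
Proof. by rewrite -intrD -rmorphD. Qed.

Lemma ratZM x y : ratZ (Z.mul x y) = ratZ x * ratZ y.
Proof. by rewrite -intrM -rmorphM. Qed.

Lemma ratZN x : ratZ (Z.opp x) = - ratZ x.
Proof. by rewrite /ratZ -[Z.opp x]/(- x) rmorphN mulrNz. Qed.

Lemma ratZ_nat n : ratZ (Z.of_nat n) = n%:R.
Proof. by rewrite /ratZ (_ : int_of_Z _ = n) //; lia. Qed.

Lemma ratZ_neq0 x : x <> Z0 -> ratZ x != 0.
Proof. by move=> x0; rewrite intr_eq0; apply/eqP; lia. Qed.

Definition ratQ (x : Q) : rat := ratZ (Qnum x) / ratZ (Zpos (Qden x)).

Lemma ratQ_red x : ratQ (Qred x) = ratQ x.
Proof.
have := Qred_correct x; rewrite /Qeq /ratQ; set y := Qred x => e.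
have := congr1 ratZ e; rewrite !ratZM => {}e.
by apply/eqP; rewrite eqr_div ?ratZ_neq0 // e.
Qed.

Lemma ratQD x y : ratQ (Qplus x y) = ratQ x + ratQ y.
Proof.
have den : ratZ (Zpos (Qden (Qplus x y))) = ratZ (QDen x) * ratZ (QDen y).
  by rewrite -ratZM.
by rewrite /ratQ den /= ratZD !ratZM addf_div ?ratZ_neq0.
Qed.

Lemma ratQM x y : ratQ (Qmult x y) = ratQ x * ratQ y.
Proof.
have den : ratZ (Zpos (Qden (Qmult x y))) = ratZ (QDen x) * ratZ (QDen y).
  by rewrite -ratZM.
by rewrite /ratQ den /= ratZM mulf_div.
Qed.

Lemma ratQN x : ratQ (Qopp x) = - ratQ x.
Proof. by rewrite /ratQ /= ratZN mulNr. Qed.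

Lemma ratQV x : ratQ (Qinv x) = (ratQ x)^-1.
Proof.
case: x => -[|n|n] d; rewrite /ratQ /Qinv /=.
- by rewrite !mul0r invr0.
- by rewrite invf_div.
- rewrite -[Zneg d]/(Z.opp (Zpos d)) -[Zneg n]/(Z.opp (Zpos n)) !ratZN.
  by rewrite invf_div invrN mulrN mulNr.
Qed.

#[local] Arguments Qred : simpl never.
#[local] Arguments Qplus : simpl never.
#[local] Arguments Qmult : simpl never.
#[local] Arguments Qinv : simpl never.

Definition Qnat (n : nat) : Q := Qmake (Z.of_nat n) xH.

#[local] Arguments Qnat : simpl never.

Lemma ratQ_nat n : ratQ (Qnat n) = n%:R.
Proof. by rewrite /ratQ ratZ_nat divr1. Qed.

Definition Qfrac (r d : nat) : Q := Qred (Qmult (Qnat r) (Qinv (Qnat d))).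

Lemma ratQ_frac r d : ratQ (Qfrac r d) = r%:R / d%:R.
Proof. by rewrite ratQ_red ratQM ratQV !ratQ_nat. Qed.

Definition Qdot (xs ys : seq Q) : Q :=
  foldr (fun xy s => Qred (Qplus (Qmult xy.1 xy.2) s)) (Qnat 0) (zip xs ys).

(** [Qrec phi ys n] lists backwards the first [n] terms of the sequence
    defined by [x_n = phi n (x_(n-1) y_1 + ... + x_0 y_n)]: both the division
    and the exponential of power series are recurrences of this shape. *)
Fixpoint Qrec (phi : nat -> Q -> Q) (ys : seq Q) (n : nat) : seq Q :=
  if n is m.+1 then
    let xs := Qrec phi ys m in Qred (phi m (Qdot xs ys)) :: xs
  else [::].

Lemma ratQ_rec (phi : nat -> Q -> Q) (psi : nat -> rat -> rat) (ys : seq Q)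
    (x y : nat -> rat) (n : nat) :
  (forall m s, (m < n)%N -> ratQ (phi m s) = psi m (ratQ s)) ->
  (forall m, x m = psi m (\sum_(i < m) x i * y (m - i)%N)) ->
  map ratQ ys = [seq y i.+1 | i <- iota 0 (size ys)] ->
  (n <= (size ys).+1)%N ->
  map ratQ (Qrec phi ys n) = rev (mkseq x n).
Proof.
move=> phiE xE ysE; elim: n phiE => // n IHn phiE lt_n /=.
have {}IHn := IHn (fun m s lt_m => phiE m s (ltnW lt_m)).
rewrite mkseqS rev_rcons -IHn 1?ltnW //; congr (_ :: _).
rewrite ratQ_red phiE // xE; congr psi.
have dotE xs zs :
    ratQ (Qdot xs zs) =
    \sum_(ab <- zip (map ratQ xs) (map ratQ zs)) ab.1 * ab.2.
  elim: xs zs => [|u xs IHxs] [|w zs]; rewrite ?big_nil ?ratQ_nat //=.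
  by rewrite big_cons -IHxs /Qdot /= ratQ_red ratQD ratQM.
rewrite dotE IHn 1?ltnW // ysE.
have -> : zip (rev (mkseq x n)) [seq y i.+1 | i <- iota 0 (size ys)] =
    [seq (x (n - i.+1)%N, y i.+1) | i <- iota 0 n].
  apply: (@eq_from_nth _ (0, 0)).
    by rewrite size_zip size_rev size_mkseq !size_map !size_iota; lia.
  move=> i; rewrite size_zip size_rev size_mkseq !size_map !size_iota => lt_i.
  have [lt_in lt_is] : (i < n)%N /\ (i < size ys)%N by lia.
  rewrite nth_zip_cond size_zip size_rev size_mkseq !size_map !size_iota lt_i.
  rewrite nth_rev size_mkseq // nth_mkseq; last by lia.
  by rewrite !(nth_map 0%N) ?size_iota // !nth_iota.
have -> : iota 0 n = index_iota 0 n by rewrite /index_iota subn0.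
rewrite big_map big_mkord /=.
rewrite (reindex_inj rev_ord_inj) /=; apply: eq_bigr => i _.
by congr (x _ * y _); have := ltn_ord i; lia.
Qed.

Definition Qpoch4 (a : seq Q) (k : nat) : Q :=
  foldr (fun x s => Qmult (Qplus x (Qnat k)) s) (Qnat 1) a.

Definition Qharm4 (a : seq Q) (k : nat) : Q :=
  foldr (fun x s => Qplus
    (Qplus (Qinv (Qplus x (Qnat k))) (Qopp (Qinv (Qplus (Qnat 1) (Qnat k))))) s)
    (Qnat 0) a.

Fixpoint Qhg (a : seq Q) (c : Q) (k : nat) (F S : Q) (n : nat) :
    seq (Q * Q) :=
  if n is m.+1 then
    let V := Qinv (Qnat k.+1) in
    (F, S) :: Qhg a c k.+1
      (Qred (Qmult F (Qmult c (Qmult (Qpoch4 a k)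
         (Qmult (Qmult V V) (Qmult V V))))))
      (Qred (Qplus S (Qharm4 a k))) m
  else [::].

Definition Qlog (a : seq Q) (c D : Q) (n : nat) : seq Q :=
  let FS := Qhg a c 0 (Qnat 1) (Qnat 0) n.+1 in
  rev (Qrec (fun m s =>
         let x := nth (Qnat 0, Qnat 0) FS m in
         Qplus (Qmult D (Qmult x.1 x.2)) (Qopp s))
       [seq x.1 | x <- behead FS] n.+1).

(** When the [c]-dilated exponential is integral, so is the [c]-dilation of
    [theta] of the logarithm; the factor [D = n!] then clears the denominators
    of the logarithm, all intermediate results are integers, and reducing
    fractions is cheap. *)
Definition Qmirror (a : seq Q) (c : Q) (n : nat) : seq Q :=
  let D := foldr Qmult (Qnat 1) [seq Qnat i.+1 | i <- iota 0 n] in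
  let V := Qinv D in
  rev (Qrec (fun m s => if m is 0%N then Qnat 1 else Qmult s (Qinv (Qnat m)))
       [seq Qred (Qmult (Qnat x.1) (Qmult x.2 V))
          | x <- zip (iota 1 n) (behead (Qlog a c D n))] n.+1).

Lemma fps_dilateM c (f g : fps) :
  fps_dilate c (f * g) = fps_dilate c f * fps_dilate c g.
Proof.
apply: fpsP => n; rewrite /fps_dilate !fps_coefM mulr_sumr.
apply: eq_bigr => i _; rewrite mulrACA -exprD subnKC //.
by rewrite -ltnS.
Qed.

Lemma theta_dilate c (f : fps) :
  theta (fps_dilate c f) = fps_dilate c (theta f).
Proof. by apply: fpsP => n; rewrite /theta /fps_dilate mulrCA. Qed.

(** The logarithm of the mirror map divided by its argument. *)
Definition cy_log (a : 4.-tuple rat) : fps := fps_div (hgG a) (hgF a).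

Lemma cy_logM a : cy_log a * hgF a = hgG a.
Proof.
rewrite [cy_log a]/(hgG a * fps_inv (hgF a)) -mulrA [fps_inv _ * _]mulrC.
by rewrite fps_inv_mul ?mulr1 // hgF_0.
Qed.

Lemma cy_log0 a : cy_log a 0%N = 0.
Proof.
rewrite -[LHS]mulr1 -(hgF_0 a) -fps_coefM0 cy_logM /hgG.
by rewrite [X in _ * X]big1 ?mulr0 // => j _; rewrite big_ord0.
Qed.

Section MirrorCoefficients.

Variables (a : 4.-tuple rat) (aq : seq Q) (c : Q).
Hypothesis aqE : map ratQ aq = a.

Let S k := \sum_(j < 4) \sum_(i < k) ((tnth a j + i%:R)^-1 - (1 + i%:R)^-1).

Lemma ratQ_poch4 k : ratQ (Qpoch4 aq k) = \prod_(j < 4) (tnth a j + k%:R).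
Proof.
rewrite -(big_tuple _ _ a xpredT (fun x => x + k%:R)) -aqE /Qpoch4.
elim: aq => [|x s IHs] /=; first by rewrite big_nil ratQ_nat.
by rewrite big_cons -IHs ratQM ratQD ratQ_nat.
Qed.

Lemma ratQ_harm4 k : ratQ (Qharm4 aq k) = S k.+1 - S k.
Proof.
have -> : S k.+1 - S k = \sum_(j < 4) ((tnth a j + k%:R)^-1 - (1 + k%:R)^-1).
  rewrite /S -sumrB; apply: eq_bigr => j _.
  by rewrite big_ord_recr /= [LHS]addrC addKr.
rewrite -(big_tuple _ _ a xpredT (fun x => (x + k%:R)^-1 - (1 + k%:R)^-1)) -aqE.
rewrite /Qharm4; elim: aq => [|x s IHs] /=; first by rewrite big_nil ratQ_nat.
by rewrite big_cons -IHs !(ratQD, ratQN, ratQV, ratQ_nat).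
Qed.

Lemma ratQ_hg k F T n i : (i < n)%N ->
  ratQ F = fps_dilate (ratQ c) (hgF a) k -> ratQ T = S k ->
  let x := nth (Qnat 0, Qnat 0) (Qhg aq c k F T n) i in
  ratQ x.1 = fps_dilate (ratQ c) (hgF a) (k + i)%N /\
    ratQ x.2 = S (k + i)%N.
Proof.
elim: n k F T i => // n IHn k F T [|i] lt_i FE TE.
  by rewrite addn0; exact: conj FE TE.
rewrite addnS -addSn; apply: IHn => //; last first.
  by rewrite ratQ_red ratQD ratQ_harm4 TE addrC subrK.
rewrite ratQ_red !(ratQM, ratQV, ratQ_nat, ratQ_poch4) FE.
rewrite /fps_dilate /hgF (exprS (ratQ c)) factS natrM exprMn.
have -> : \prod_(j < 4) pochhammer (tnth a j) k.+1 =
   (\prod_(j < 4) pochhammer (tnth a j) k) * \prod_(j < 4) (tnth a j + k%:R).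
  by rewrite -big_split; apply: eq_bigr => j _; apply: big_ord_recr.
by field; rewrite nat1r !pnatr_eq0 -lt0n fact_gt0.
Qed.

Lemma size_Qhg k F T n : size (Qhg aq c k F T n) = n.
Proof. by elim: n k F T => //= n IHn k F T; rewrite IHn. Qed.

Lemma ratQ_log D n : map ratQ (Qlog aq c D n) =
  mkseq (fun m => ratQ D * fps_dilate (ratQ c) (cy_log a) m) n.+1.
Proof.
rewrite /Qlog; set FS := Qhg _ _ _ _ _ _.
have FSE i : (i <= n)%N -> let x := nth (Qnat 0, Qnat 0) FS i in
    ratQ x.1 = fps_dilate (ratQ c) (hgF a) i /\ ratQ x.2 = S i.
  move=> le_i; apply: (@ratQ_hg 0); rewrite ?ratQ_nat ?ltnS //.
    by rewrite /fps_dilate hgF_0 mulr1.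
  by rewrite /S big1 // => j _; rewrite big_ord0.
rewrite map_rev.
rewrite (@ratQ_rec _ (fun m s => ratQ D * fps_dilate (ratQ c) (hgG a) m - s) _
  (fun m => ratQ D * fps_dilate (ratQ c) (cy_log a) m)
  (fps_dilate (ratQ c) (hgF a))).
- by rewrite revK.
- move=> m s; rewrite ltnS => /FSE[x1 x2].
  rewrite ratQD ratQN !ratQM x1 x2; congr (_ * _ - _).
  by rewrite /fps_dilate /hgG mulrA.
- move=> m; rewrite -cy_logM fps_dilateM fps_coefM big_ord_recr /= subnn.
  have -> : fps_dilate (ratQ c) (hgF a) 0 = 1.
    by rewrite /fps_dilate hgF_0 mulr1.
  rewrite mulr1 mulrDr mulr_sumr.
  under [X in _ = _ + _ - X]eq_bigr do rewrite -mulrA.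
  by rewrite addrAC subrr add0r.
- apply: (@eq_from_nth _ 0); first by rewrite !size_map size_iota.
  move=> i; rewrite !size_map size_behead size_Qhg => lt_i.
  rewrite -map_comp (nth_map (Qnat 0, Qnat 0)) ?size_behead ?size_Qhg //.
  rewrite nth_behead (nth_map 0%N) ?size_iota ?nth_iota ?add0n //.
  by case: (FSE i.+1).
- by rewrite size_map size_behead size_Qhg.
Qed.

Lemma ratQ_mirror n : map ratQ (Qmirror aq c n) =
  mkseq (fps_dilate (ratQ c) (fps_exp (cy_log a))) n.+1.
Proof.
rewrite /Qmirror map_rev; set D := foldr _ _ _.
have D0 : ratQ D != 0.
  rewrite /D; elim: (iota 0 n) => [|m s IHs] //.
  by rewrite /= ratQM mulf_neq0 // ratQ_nat pnatr_eq0.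
have sizeL : size (Qlog aq c D n) = n.+1.
  by rewrite -(size_map ratQ) ratQ_log size_mkseq.
pose psi m s : rat := if m is 0%N then 1 else s / m%:R.
rewrite (@ratQ_rec _ psi _ (fps_dilate (ratQ c) (fps_exp (cy_log a)))
  (theta (fps_dilate (ratQ c) (cy_log a)))).
- by rewrite revK.
- by case=> [|m] s _; rewrite /psi /= ?ratQM ?ratQV ?ratQ_nat.
- case=> [|m]; first by rewrite /psi /fps_dilate fps_exp0 mulr1.
  rewrite /psi -theta_log_coef; last first.
    by rewrite !theta_dilate theta_exp ?cy_log0 // fps_dilateM.
  by rewrite mulrC mulKf // pnatr_eq0.
- have sz : size (zip (iota 1 n) (behead (Qlog aq c D n))) = n.
    by rewrite size_zip size_iota size_behead sizeL /= minnn.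
  apply: (@eq_from_nth _ 0); first by rewrite !size_map size_iota.
  move=> i; rewrite !size_map sz => lt_i.
  rewrite (nth_map (Qnat 0)) ?size_map ?sz // (nth_map (0%N, Qnat 0)) ?sz //.
  rewrite nth_zip ?size_iota ?size_behead ?sizeL // nth_iota // nth_behead /=.
  rewrite (nth_map 0%N) ?size_iota // nth_iota // add0n add1n.
  rewrite ratQ_red !ratQM ratQV ratQ_nat.
  rewrite -(nth_map (Qnat 0) 0 ratQ) ?sizeL ?ltnS // ratQ_log nth_mkseq //.
  by rewrite /theta mulrAC mulfV // mul1r.
- by rewrite size_map size_zip size_iota size_behead sizeL /= minnn.
Qed.

End MirrorCoefficients.

(** * The primes that must divide the dilation *)

Definition Qnum_ndvd (p m : nat) (x : Q) : bool :=
  ~~ Z.eqb (Z.modulo (Qnum x) (Z.pow (Z.of_nat p) (Z.of_nat m))) Z0.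

Lemma Qnum_ndvdP p m x : Qnum_ndvd p m x ->
  ~~ (p ^ m %| `|int_of_Z (Qnum x)|)%N.
Proof.
apply: contra => /dvdnP[q].
have -> : Z.pow (Z.of_nat p) (Z.of_nat m) = Z.of_nat (p ^ m) by lia.
case: x => z d /=; set P := (p ^ m)%N => eq_z.
suff [c ->] : exists c, z = Z.mul c (Z.of_nat P) by rewrite Zdiv.Z_mod_mult.
have [z_ge0|z_lt0] := Z.le_gt_cases Z0 z.
  by exists (Z.of_nat q); lia.
by exists (Z.opp (Z.of_nat q)); lia.
Qed.

(** With [v = logn p N] and [v <= e - 1], the integrality of [N ^ (k + 1) E]
    would give [c ^ k E] a [p]-adic valuation of at least
    [e k - (e - 1) (k + 1) = k - e + 1]. *)
Lemma logn_dilation (p e k c N : nat) (E : rat) (x : Q) : prime p ->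
  (0 < N)%N -> (0 < c)%N -> (p ^ e %| c)%N -> (e <= k)%N ->
  N%:R ^+ k.+1 * E \is a Num.int ->
  ratQ x = c%:R ^+ k * E ->
  Qnum_ndvd p (k - e).+1 x ->
  (e <= logn p N)%N.
Proof.
move=> p_pr N_gt0 c_gt0 pc le_ek /intrP[z Ez] xE /Qnum_ndvdP.
rewrite leqNgt; apply: contra => lt_v.
set u := int_of_Z (Qnum x); set w := int_of_Z (Zpos (Qden x)).
have w0 : w%:~R != 0 :> rat by apply: (@ratZ_neq0 (Zpos (Qden x))).
have eq_z : z * (c ^ k)%N%:Z * w = (N ^ k.+1)%N%:Z * u.
  have numE : u%:~R = ratQ x * w%:~R by rewrite /ratQ divfK.
  apply: (@intr_inj rat); rewrite !intrM -Ez numE xE -!pmulrn !natrX.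
  by ring.
have {eq_z} : (p ^ (e * k) %| N ^ k.+1 * `|u|)%N.
  have := congr1 absz eq_z; rewrite !abszM !absz_nat => <-.
  by rewrite dvdn_mulr // dvdn_mull // expnM dvdn_exp2r.
have [m pm defN] := pfactor_coprime p_pr N_gt0.
set v := logn p N in defN lt_v; rewrite defN expnMn -expnM.
have -> : (e * k = (k - e).+1 + (e * k - v * k.+1 - (k - e).+1) + v * k.+1)%N.
  by nia.
rewrite expnD [(m ^ _ * _)%N]mulnC -mulnA mulnC dvdn_pmul2l; last first.
  by rewrite expn_gt0 prime_gt0.
rewrite Gauss_dvdr ?coprimeXl ?coprimeXr //.
by apply: dvdn_trans; rewrite expnD dvdn_mulr.
Qed.

(** Each row lists [r1, d1, (r2, d2)] for [alpha = r1 / d1] and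
    [beta = r2 / d2], and triples [(p, e, k)]: [p ^ e] divides the dilation, as
    is visible on the coefficient of [z ^ k]. *)
Definition cy_rows : seq (nat * nat * (nat * nat) * seq (nat * nat * nat)) :=
  [:: (1, 2, (1, 2), [:: (2, 8, 16)]);
      (1, 3, (2, 3), [:: (3, 6, 9)]);
      (1, 4, (1, 2), [:: (2, 10, 16)]);
      (1, 4, (1, 4), [:: (2, 12, 16)]);
      (2, 5, (1, 5), [:: (5, 5, 5)]);
      (3, 8, (1, 8), [:: (2, 16, 24)]);
      (3, 10, (1, 10), [:: (2, 8, 16); (5, 5, 5)]);
      (1, 2, (1, 6), [:: (2, 8, 16); (3, 3, 6)]);
      (1, 2, (1, 3), [:: (2, 4, 4); (3, 3, 6)]);
      (1, 3, (1, 6), [:: (2, 4, 4); (3, 6, 9)]);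
      (1, 6, (1, 6), [:: (2, 8, 16); (3, 6, 9)]);
      (1, 3, (1, 4), [:: (2, 6, 8); (3, 3, 3)]);
      (1, 4, (1, 6), [:: (2, 10, 16); (3, 3, 3)]);
      (5, 12, (1, 12), [:: (2, 12, 16); (3, 6, 9)])]%N.

Lemma cy_pairsE : cy_pairs =
  [seq (x.1.1.1%:R / x.1.1.2%:R, x.1.2.1%:R / x.1.2.2%:R) | x <- cy_rows].
Proof. by []. Qed.

Definition row_const (L : seq (nat * nat * nat)) : nat :=
  foldr (fun x s => x.1.1 ^ x.1.2 * s)%N 1%N L.

Definition Qrow_const (L : seq (nat * nat * nat)) : Q :=
  foldr (fun x s => Qmult (iter x.1.2 (Qmult (Qnat x.1.1)) (Qnat 1)) s)
    (Qnat 1) L.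

Lemma ratQ_row_const L : ratQ (Qrow_const L) = (row_const L)%:R.
Proof.
elim: L => [|[[p e] k] L IHL] /=; first by rewrite ratQ_nat.
rewrite ratQM IHL natrM natrX; congr (_ * _).
by elim: e => [|e IHe] /=; rewrite ?ratQ_nat // ratQM IHe ratQ_nat exprS.
Qed.

Definition Qcy (r1 d1 r2 d2 : nat) : seq Q :=
  [:: Qfrac r1 d1; Qfrac r2 d2; Qfrac (d1 - r1) d1; Qfrac (d2 - r2) d2].

Definition row_check (x : nat * nat * (nat * nat) * seq (nat * nat * nat)) :=
  let: (r1, d1, (r2, d2), L) := x in
  let n := foldr maxn 0%N [seq t.2 | t <- L] in
  let E := Qmirror (Qcy r1 d1 r2 d2) (Qrow_const L) n in
  [&& (0 < r1 < d1)%N, (0 < r2 < d2)%N, all (fun t => (0 < t.1.1)%N) L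
    & all (fun p => has (fun t => [&& t.1.1 == p,
            (cy_slope d1 d2 p <= p.-1 * t.1.2)%N,
            (t.1.2 <= t.2 <= n)%N
          & Qnum_ndvd p (t.2 - t.1.2).+1 (nth (Qnat 0) E t.2)]) L)
        (primes (d1 * d2))].

Lemma cy_rows_check : all row_check cy_rows.
Proof. by vm_compute. Qed.

Lemma fps_X_mulS (f : fps) k : (fps_X * f) k.+1 = f k.
Proof.
rewrite fps_coefM 2!big_ord_recl big1 => [|i _]; last exact: mul0r.
by rewrite [X in X + _]mul0r add0r addr0 [fps_X _]/(1%:R) mul1r subSS subn0.
Qed.

Lemma dilate_mirrorS (c : rat) (a : 4.-tuple rat) k :
  fps_dilate c (mirror_map a) k.+1 = c ^+ k.+1 * fps_exp (cy_log a) k.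
Proof. by rewrite -(fps_X_mulS (fps_exp (cy_log a))). Qed.

(** The integrality of the dilated mirror map makes the [p]-part of [N] large
    enough for [zloc_hgF] to apply at every prime [p]. *)
Lemma cy_slope_dilation (r1 d1 r2 d2 N : nat) L (p : nat) :
  row_check (r1, d1, (r2, d2), L) -> (0 < N)%N ->
  fps_integral (fps_dilate N%:R
    (mirror_map (cy_param (r1%:R / d1%:R) (r2%:R / d2%:R)))) ->
  prime p -> (cy_slope d1 d2 p <= p.-1 * logn p N)%N.
Proof.
rewrite /row_check; set n := foldr _ _ _.
set a := cy_param _ _; set E := Qmirror _ _ _.
move=> /and4P[rd1 rd2 L_gt0 /allP row_p] N_gt0 intN p_pr.
have [p_d|p_d] := boolP (p \in primes (d1 * d2)); last first.
  suff -> : cy_slope d1 d2 p = 0%N by [].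
  have d12_gt0 : (0 < d1 * d2)%N by rewrite muln_gt0; lia.
  move: p_d; rewrite mem_primes p_pr d12_gt0 /= Euclid_dvdM // negb_or.
  case/andP=> p_d1 p_d2; rewrite /cy_slope (negbTE p_d1) (negbTE p_d2).
  rewrite (lognE p d1) (lognE p d2) (negbTE p_d1) (negbTE p_d2).
  by rewrite !andbF !muln0.
have /hasP[[[q e] k] Lx /and4P[/eqP /= eq_q le_e /andP[le_ek le_kn] ndvd]] :=
  row_p p p_d.
rewrite {}eq_q {q} in Lx; apply: leq_trans le_e _; rewrite leq_mul2l.
apply/orP; right.
have aqE : map ratQ (Qcy r1 d1 r2 d2) = a.
  by rewrite /a cy_param_frac /= ?ratQ_frac //; lia.
have [c_gt0 pc] : (0 < row_const L)%N /\ (p ^ e %| row_const L)%N.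
  elim: L Lx L_gt0 {row_p ndvd le_kn n E} => //= t L IHL.
  rewrite inE => Lx /andP[t_gt0 L_gt0].
  have c_gt0 : (0 < row_const L)%N.
    elim: L L_gt0 {IHL Lx} => //= t' L IHL /andP[t'_gt0 /IHL].
    by rewrite muln_gt0 expn_gt0 t'_gt0.
  rewrite muln_gt0 expn_gt0 t_gt0 c_gt0; split=> //.
  case/orP: Lx => [/eqP <-|Lx]; first by rewrite dvdn_mulr.
  by rewrite dvdn_mull //; case: (IHL Lx L_gt0).
have := ratQ_mirror (Qrow_const L) aqE n; rewrite -/E => mirrorE.
have sizeE : size E = n.+1 by rewrite -(size_map ratQ) mirrorE size_mkseq.
apply: (@logn_dilation p e k (row_const L) N (fps_exp (cy_log a) k)
          (nth (Qnat 0) E k)) => //.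
  by have := intN k.+1; rewrite dilate_mirrorS.
rewrite -(nth_map (Qnat 0) 0 ratQ) ?sizeE ?ltnS // mirrorE nth_mkseq ?ltnS //.
by rewrite /fps_dilate ratQ_row_const.
Qed.

(** * Integrality of the mirror map and of its inverse *)

Lemma fps_integralM (f g : fps) :
  fps_integral f -> fps_integral g -> fps_integral (f * g).
Proof. by move=> fZ gZ n; apply: rpred_sum => i _; apply: rpredM. Qed.

Lemma fps_integral_theta (f : fps) : fps_integral f -> fps_integral (theta f).
Proof. by move=> fZ n; apply: rpredM; rewrite ?natr_int. Qed.

Lemma fps_coefX_int (f : fps) (m n : nat) :
  (forall i, (i <= n)%N -> f i \is a Num.int) -> (f ^+ m) n \is a Num.int.
Proof.
elim: m n => [|m IHm] n fZ; first by rewrite expr0 fps_coef1 natr_int.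
rewrite exprS fps_coefM; apply: rpred_sum => i _; apply: rpredM.
  by apply: fZ; rewrite -ltnS.
by apply: IHm => j le_j; apply: fZ; rewrite (leq_trans le_j) ?leq_subr.
Qed.

Lemma fps_integral_comp (f g : fps) :
  fps_integral f -> fps_integral g -> fps_integral (fps_comp f g).
Proof.
move=> fZ gZ n; apply: rpred_sum => m _; rewrite fps_powE.
by apply: rpredM => //; apply: fps_coefX_int.
Qed.

(** The coefficient of degree [n] of [f (g (z)) = z] equates [g_n] with a
    polynomial in the coefficients of [f] and in the earlier ones of [g]. *)
Lemma fps_integral_inverse (f g : fps) : is_comp_inverse f g ->
  f 1%N = 1 -> fps_integral f -> fps_integral g.
Proof.
move=> [f0 g0 fg _] f1 fZ; elim/ltn_ind => -[_|n IHn]; first by rewrite g0.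
have := fg n.+1; rewrite (@fps_compE f g n.+2) // 2!big_ord_recl f0 mul0r add0r.
have -> : nat_of_ord (lift ord0 ord0 : 'I_n.+2) = 1%N by [].
rewrite f1 mul1r expr1.
move/(canRL (addrK _)) ->; apply: rpredB; first exact: natr_int.
apply: rpred_sum => m _; apply: rpredM => //.
rewrite !lift0 exprS fps_coefM.
apply: rpred_sum => i _; case: i => -[|i] /= lt_i.
  by rewrite g0 mul0r.
have [lt_in|le_ni] := ltnP i n; last first.
  have -> : (n.+1 - i.+1 = 0)%N by lia.
  by rewrite fps_coefX0 g0 expr0n mulr0.
apply: rpredM; first exact: IHn.
by apply: fps_coefX_int => j le_j; apply: IHn; lia.
Qed.

(** The coefficient of degree [k + 1] of the dilated mirror map is [N h_k], so
    the denominators of [h] are bounded by [N]. *)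
Lemma fps_integral_mirror (r1 d1 r2 d2 N : nat) :
  (0 < r1 < d1)%N -> (0 < r2 < d2)%N -> (0 < N)%N ->
  let a := cy_param (r1%:R / d1%:R) (r2%:R / d2%:R) in
  (forall p, prime p -> (cy_slope d1 d2 p <= p.-1 * logn p N)%N) ->
  fps_integral (fps_dilate N%:R (mirror_map a)) ->
  fps_integral (fps_dilate N%:R (fps_exp (cy_log a))).
Proof.
move=> rd1 rd2 N_gt0 a slopeN intN n; apply: zloc_all_int => p p_pr.
set h := fps_dilate _ _; set g := fps_dilate N%:R (cy_log a).
have h0 : h 0%N = 1 by rewrite /h /fps_dilate fps_exp0 mulr1.
have g0 : g 0%N = 0 by rewrite /g /fps_dilate cy_log0 mulr0.
have gF : g * fps_dilate N%:R (hgF a) = fps_dilate N%:R (hgG a).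
  by rewrite -fps_dilateM cy_logM.
apply: (@zloc_of_bounded p (d1 + d2) (logn p N) g h) => //.
- by rewrite theta_dilate theta_exp ?cy_log0 // fps_dilateM theta_dilate.
- move=> t; elim/ltn_ind => k IHk le_k.
  have -> : g k = fps_dilate N%:R (hgG a) k -
      \sum_(i < k) g i * fps_dilate N%:R (hgF a) (k - i)%N.
    rewrite -gF fps_coefM big_ord_recr /= subnn.
    have -> : fps_dilate N%:R (hgF a) 0 = 1.
      by rewrite /fps_dilate hgF_0 mulr1.
    by rewrite mulr1 addrAC subrr add0r.
  rewrite mulrBr; apply: rpredB; first by apply: zloc_hgG => //; apply: slopeN.
  rewrite mulr_sumr; apply: rpred_sum => i _; rewrite mulrA.
  apply: rpredM; last by apply: zloc_hgF => //; apply: slopeN.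
  by apply: IHk => //; apply: leq_trans (ltnW (ltn_ord i)) le_k.
- move=> k; have := intN k.+1.
  rewrite dilate_mirrorS exprS -mulrA -/(h k) => Nh.
  have [m pm defN] := pfactor_coprime p_pr N_gt0.
  have m0 : m%:R != 0 :> rat.
    by rewrite pnatr_eq0; apply: contraTneq N_gt0 => m0; rewrite defN m0.
  have -> : p%:R ^+ logn p N * h k = m%:R^-1 * (N%:R * h k).
    by rewrite [in RHS]defN natrM natrX -mulrA mulKf.
  by rewrite rpredM ?zloc_natV // zloc_int.
Qed.

Lemma fps_integral_theta_log (g h : fps) : h 0%N = 1 ->
  theta h = h * theta g -> fps_integral h -> fps_integral (theta g).
Proof.
move=> h0 eq_h hZ; elim/ltn_ind => n IHn.
have -> : theta g n = theta h n - \sum_(i < n) h i.+1 * theta g (n - i.+1)%N.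
  by rewrite eq_h fps_coefM big_ord_recl h0 mul1r subn0 addrK.
apply: rpredB; first exact: fps_integral_theta.
apply: rpred_sum => i _; apply: rpredM => //; apply: IHn.
by have := ltn_ord i; lia.
Qed.

(** * Integrality of the seven series *)

Theorem corollary1 (alpha beta : rat) (N : nat) (zq : fps) :
  (alpha, beta) \in cy_pairs ->
  is_smallest_integral_dilation (cy_param alpha beta) N ->
  is_comp_inverse
    (fps_scale (N%:R)^-1
       (fps_dilate N%:R (mirror_map (cy_param alpha beta)))) zq ->
  forall i : nat, (i <= 6)%N ->
    fps_integral (fps_comp (u_series (cy_param alpha beta) N i) zq).
Proof.
rewrite cy_pairsE => /mapP[[[[r1 d1] [r2 d2]] L] /(allP cy_rows_check) row_ok].
move=> /= [-> ->]; set a := cy_param _ _ => -[N_gt0 intN _] zqE i le_i.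
have slopeN p : prime p -> (cy_slope d1 d2 p <= p.-1 * logn p N)%N.
  exact: cy_slope_dilation row_ok N_gt0 intN.
have [rd1 rd2] : (0 < r1 < d1)%N /\ (0 < r2 < d2)%N by case/and4P: row_ok.
set h := fps_dilate N%:R (fps_exp (cy_log a)).
have hZ : fps_integral h by apply: fps_integral_mirror.
have h0 : h 0%N = 1 by rewrite /h /fps_dilate fps_exp0 mulr1.
set F := fps_dilate N%:R (hgF a); set G := fps_dilate N%:R (hgG a).
set g := fps_dilate N%:R (cy_log a).
have FZ : fps_integral F.
  move=> k; apply: zloc_all_int => p p_pr.
  by apply: zloc_hgF => //; apply: slopeN.
have gZ : fps_integral (theta g).
  apply: (fps_integral_theta_log h0) => //.
  by rewrite theta_dilate theta_exp ?cy_log0 // fps_dilateM theta_dilate.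
have N0 : N%:R != 0 :> rat by rewrite pnatr_eq0 -lt0n.
have qE : fps_scale (N%:R)^-1 (fps_dilate N%:R (mirror_map a)) = fps_X * h.
  apply: fpsP => -[|k].
    by rewrite fps_coefM0 /fps_scale /fps_dilate [mirror_map a 0%N]fps_coefM0
               !mul0r !mulr0.
  by rewrite fps_X_mulS /fps_scale dilate_mirrorS exprS -mulrA mulKf.
have XZ : fps_integral fps_X by move=> k; apply: natr_int.
have zqZ : fps_integral zq.
  apply: (fps_integral_inverse zqE); rewrite qE.
    by rewrite fps_X_mulS.
  exact: fps_integralM.
apply: fps_integral_comp zqZ.
have GE : G = g * F by rewrite -fps_dilateM cy_logM.
have W1 : F * theta G - G * theta F = F * F * theta g.
  by rewrite GE thetaM; ring.
have W2 : F * theta (theta G) - G * theta (theta F) =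
          theta (F * theta G - G * theta F).
  by rewrite thetaD thetaN !thetaM; ring.
have W1Z : fps_integral (F * theta G - G * theta F).
  by rewrite W1; do !apply: fps_integralM.
rewrite /u_series; case: i le_i => [|[|[|[|[|[|[|//]]]]]]] _ //=;
  do ?apply: fps_integral_theta => //.
have -> : fps_sub (fps_mul F (theta (theta G))) (fps_mul G (theta (theta F))) =
  theta (F * theta G - G * theta F) by rewrite -W2.
exact: fps_integral_theta.
Qed.
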